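(* (i) For every integer $n>2$, $$\sum_{m=1}^{n-1}K_{\leq}(n-m)\sigma(m)\equiv\sum_{m=1}^{\lceil\frac{1+\sqrt{1+24n}}{6}\rceil-1}(-1)^{m}m P_m\,p(n-P_m)+\sum_{m=1}^{\lceil\frac{-1+\sqrt{1+24n}}{6}\rceil-1}(-1)^{m}mP_{-m}\,p(n-P_{-m})\pmod n.$$ (ii) For every integer $n>3$, $$\sum_{m=1}^{n-1}K_{<}(n-m)\sigma(m)-\sum_{m=1}^{n}K_{<}(n-m+1)\sigma(m)+\sum_{m= 1}^{\lceil\frac{-3+\sqrt{9+24n}}{6}\rceil-1}(-1)^{m-1}3T_m\,p(n-3T_m)$$ $$+\sum_{m= 0}^{\lfloor\frac{-1+\sqrt{1+24n}}{6}\rfloor}(-1)^{m-1}P_{-m}\,p(n-P_{-m})\equiv 0\pmod n.$$ (iii) For every integer $n>2$, $$\sum_{m=1}^{n-1}K_{>}(n-m)\sigma(m)\equiv\sum_{m=1}^{\lceil\frac{1+\sqrt{1+24n}}{6}\rceil-1}(-1)^{m-1}(m-1) P_m\,p(n-P_m)+\sum_{m=1}^{\lceil\frac{-1+\sqrt{1+24n}}{6}\rceil-1}(-1)^{m-1}(m-1)P_{-m}\,p(n-P_{-m})\pmod n.$$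
   Context: For a partition $\pi$ of a positive integer $n$, the Kimberling index is $K(\pi)=(\text{largest part of }\pi)-(\text{least part of }\pi)-(\text{number of parts of }\pi)$. $K_{\leq}(n)$, $K_{<}(n)$, $K_{>}(n)$ denote the numbers of partitions $\pi$ of $n$ with $K(\pi)\le 0$, $K(\pi)<0$, $K(\pi)>0$ respectively. $p(n)$ is the number of partitions of $n$, with $p(0)=1$. $\sigma(m)$ is the sum of the positive divisors of $m$. For $m\in\mathbb{Z}$, $P_m=\frac{m(3m-1)}{2}$; for an integer $m\ge 0$, $T_m=\frac{m(m+1)}{2}$. *)

(* Defs.v *)
From mathcomp Require Import all_boot all_order all_algebra.
From mathcomp Require Import reals.
Set Implicit Arguments.
Unset Strict Implicit.
Unset Printing Implicit Defensive.
Import Order.TTheory GRing.Theory Num.Theory.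
Local Open Scope ring_scope.

(* A partition of n is the weakly decreasing sequence of its (positive) parts. *)
Definition int_partition (n : nat) (s : seq nat) : bool :=
  [&& sorted geq s, 0%N \notin s & sumn s == n].

(* As the parts decrease, the largest is the head and the least is the last;
   on the empty partition (n = 0) the value 0 is a dummy. *)
Definition kimberling (s : seq nat) : int :=
  (head 0%N s)%:Z - (last 0%N s)%:Z - (size s)%:Z.

(* A partition of n has at most n parts, all at most n, so that counting inside
   the finite type {bseq n of 'I_n.+1} misses none (int_partition_repr). *)
Definition count_partitions (n : nat) (Q : pred (seq nat)) : nat :=
  #|[set s : {bseq n of 'I_n.+1} |
      int_partition n (map val s) && Q (map val s)]|.

Lemma int_partition_repr (n : nat) (s : seq nat) :
  int_partition n s -> exists t : {bseq n of 'I_n.+1}, map val t = s.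
Proof.
case/and3P=> _ s0 /eqP <-.
have le_part x : x \in s -> (x <= sumn s)%N.
  by elim: {s0} s => //= y s IHs; rewrite inE => /predU1P[->|/IHs];
    [exact: leq_addr | move/leq_trans; apply; exact: leq_addl].
have sz : (size s <= sumn s)%N.
  elim: s s0 {le_part} => //= y s IHs; rewrite inE negb_or eq_sym -lt0n.
  by case/andP=> y0 /IHs; rewrite -add1n; exact: leq_add.
have szt : (size (map (@inord (sumn s)) s) <= sumn s)%N by rewrite size_map.
exists (Bseq szt) => /=; rewrite -map_comp -[RHS]map_id.
by apply/eq_in_map => x /le_part lex /=; rewrite inordK.
Qed.

Definition Kle (n : nat) : nat := count_partitions n (fun s => kimberling s <= 0).
Definition Klt (n : nat) : nat := count_partitions n (fun s => kimberling s < 0).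
Definition Kgt (n : nat) : nat := count_partitions n (fun s => 0 < kimberling s).

(* The argument is an integer so that p (n - P m) involves no truncated
   subtraction; the value at negative integers is the usual 0. *)
Definition p (k : int) : nat :=
  if k is Posz n then count_partitions n xpredT else 0%N.

Definition sigma (m : nat) : nat := (\sum_(d <- divisors m) d)%N.

Definition P (m : int) : int := ((m * (3 * m - 1)) %/ 2)%Z.

Definition T (m : nat) : nat := ((m * (m + 1)) %/ 2)%N.

(* Main.v *)
(** With q marking the size, write (q)_r for the product of the first r factors
    1 - q^i and [n, N] for the Gaussian binomials. Splitting a partition by its
    number r of parts and its least part s, and subtracting s from every part,
    leaves a partition in a box; hence the partitions whose largest part exceeds
    the least one by at most r - 1 + e have generating function
      F_e = sum_r q^r / (q)_r * prod_(i < r-1) (1 - q^(r+e+i)),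
    where e = 1 counts K <= 0 and e = 0 counts K < 0. By the q-binomial theorem
      F_e = sum_N (-1)^N q^(N(N-1)/2 + eN) U_N,
      U_N = sum_r q^((N+1)r) [r-1, N] / (q)_r,
    and Pascal's rule with Euler's identity sum_j q^(Mj) / (q)_j = 1 / (q^M)_oo
    yields U_(M-1) + q^M U_M = q^(M^2) (1 + q^M) / (q)_oo. Telescoping gives
      (q)_oo F_1 = sum_(m > 0) (-1)^(m-1) m (q^(P_m) + q^(P_(-m)))
    and a similar formula for (q - 1) F_0; N = 0 is the pentagonal number theorem.
    Finally, if p is the partition series and S the series of sigma, then
    q p' = p S, so (q)_oo F = B implies F S = B q p', whose n-th coefficient is
    sum_k b_k (n - k) p(n - k). *)

Require Import Defs.
From HB Require Import structures.
From mathcomp Require Import all_boot all_order all_algebra.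
From mathcomp Require Import reals.
From mathcomp Require Import zify ring lra qpoly.
Import Order.TTheory GRing.Theory Num.Theory.
Local Open Scope ring_scope.

(** * The q-binomial theorem *)

Fixpoint qbin (A : comNzRingType) (x : A) (n k : nat) : A :=
  match n, k with
  | _, 0 => 1
  | 0, _.+1 => 0
  | n'.+1, k'.+1 => qbin A x n' k' + x ^+ k * qbin A x n' k
  end.

(** For [m <= n] this is [(x)_n / (x)_m], again free of division. *)
Definition qprod (A : comNzRingType) (x : A) (m n : nat) : A :=
  \prod_(m <= i < n) (1 - x ^+ i.+1).

Arguments qbin {A} x n k.
Arguments qprod {A} x m n.

Section QBinomial.
Context (A : comNzRingType) (x : A).

Lemma qprod_id n : qprod x n n = 1.
Proof. by rewrite /qprod big_geq. Qed.

Lemma qprodS m n : (m <= n)%N -> qprod x m n.+1 = qprod x m n * (1 - x ^+ n.+1).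
Proof. by move=> mn; rewrite /qprod big_nat_recr. Qed.

Lemma qprodSl m n : (m < n)%N -> qprod x m n = (1 - x ^+ m.+1) * qprod x m.+1 n.
Proof. by move=> mn; rewrite /qprod big_ltn. Qed.

Lemma qprod_cat m n k : (m <= n)%N -> (n <= k)%N ->
  qprod x m k = qprod x m n * qprod x n k.
Proof. by move=> mn nk; rewrite /qprod (big_cat_nat mn nk). Qed.

Lemma qbin0 n : qbin x n 0 = 1.
Proof. by case: n. Qed.

Lemma qbinS n k : qbin x n.+1 k.+1 = qbin x n k + x ^+ k.+1 * qbin x n k.+1.
Proof. by []. Qed.

Lemma qbin_small n k : (n < k)%N -> qbin x n k = 0.
Proof.
elim: n k => [|n IHn] [|k] //; rewrite ltnS => nk.
by rewrite qbinS !IHn ?mulr0 ?addr0 // ltnW.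
Qed.

(** The quotient formula multiplied out; Pascal's rule meets
    [1 - x^(a+b) = x^a (1 - x^b) + (1 - x^a)] with [a = k + 1], [b = j + 1]. *)
Lemma qbin_qprod k j : qbin x (k + j) k * qprod x 0 k * qprod x 0 j = qprod x 0 (k + j).
Proof.
elim: k j => [|k IHk] j; first by rewrite qbin0 qprod_id !mul1r.
elim: j => [|j IHj].
  by have := IHk 0; rewrite addSn qbinS addn0 [qbin x k k.+1]qbin_small // mulr0 addr0
    qprod_id !mulr1 qprodS // mulrA => ->.
rewrite addSn qbinS -[RHS]/(qprod x 0 (k + j.+1).+1) [RHS]qprodS //.
have /(congr1 ( *%R (1 - x ^+ k.+1))) := IHk j.+1.
move: IHj; rewrite addSnnS -addSnnS => /(congr1 ( *%R (x ^+ k.+1 * (1 - x ^+ j.+1)))).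
rewrite addSnnS => E1 E2.
have -> : 1 - x ^+ (k + j.+1).+1 = x ^+ k.+1 * (1 - x ^+ j.+1) + (1 - x ^+ k.+1).
  by rewrite -addSn exprD; ring.
rewrite mulrDr ![qprod x 0 (k + j.+1) * _]mulrC -E1 -E2.
by rewrite !qprodS //; ring.
Qed.

(** Removing the factor [i = 0] leaves the same product at [z * x], so the induction runs over all
    [z]. *)
Lemma qbinomial n z :
  \prod_(0 <= i < n) (1 - z * x ^+ i) =
  \sum_(0 <= k < n.+1) (-1) ^+ k * x ^+ 'C(k, 2) * qbin x n k * z ^+ k.
Proof.
elim: n z => [|n IHn] z; first by rewrite big_geq // big_nat1 qbin0 !mulr1.
rewrite big_nat_recl // expr0 mulr1.
have -> : \prod_(0 <= i < n) (1 - z * x ^+ i.+1) =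
          \prod_(0 <= i < n) (1 - (z * x) * x ^+ i).
  by apply: eq_bigr => i _; rewrite exprS mulrA.
rewrite IHn mulrBl mul1r [RHS]big_nat_recl // qbin0.
under [in RHS]eq_bigr => k _ do rewrite qbinS mulrDr mulrDl.
rewrite big_split /= [X in X - _]big_nat_recl // qbin0.
have -> : \sum_(0 <= i < n) (-1) ^+ i.+1 * x ^+ 'C(i.+1, 2) * qbin x n i.+1 * (z * x) ^+ i.+1
  = \sum_(0 <= i < n.+1) (-1) ^+ i.+1 * x ^+ 'C(i.+1, 2)
                              * (x ^+ i.+1 * qbin x n i.+1) * z ^+ i.+1.
  rewrite [RHS]big_nat_recr //= [qbin x n n.+1]qbin_small // !mulr0 !mul0r addr0.
  by apply: eq_bigr => i _; rewrite exprMn; ring.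
rewrite mulr_sumr -sumrN [X in _ = _ + (X + _)](eq_bigr (fun k =>
  - (z * ((-1) ^+ k * x ^+ 'C(k, 2) * qbin x n k * (z * x) ^+ k)))).
  by rewrite addrAC addrA.
by move=> k _; rewrite binS bin1 exprMn !exprD !exprS; ring.
Qed.

End QBinomial.

(** * Identities modulo x^(L+1) *)

Section Nilpotent.
Context (A : comNzRingType) (x : A) (L : nat).
Hypothesis xL : x ^+ L.+1 = 0.

Lemma expr_nil n : (L < n)%N -> x ^+ n = 0.
Proof. by move=> Ln; rewrite -(subnK Ln) exprD xL mulr0. Qed.

(** The geometric series of the nilpotent [x^k] is a finite inverse of [1 - x^k]. *)
Lemma lreg_1subX k : (0 < k)%N -> GRing.lreg (1 - x ^+ k).
Proof.
move=> k0; apply: (can_inj (g := *%R (\sum_(i < L.+1) (x ^+ k) ^+ i))) => y.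
rewrite mulrA [_ * (1 - _)]mulrC -[1 - _]opprB mulNr -subrX1.
by rewrite -exprM expr_nil ?opprB ?subr0 ?mul1r // mulnC leq_pmulr.
Qed.

Lemma qprod_lreg m n : GRing.lreg (qprod x m n).
Proof.
apply: (big_ind (@GRing.lreg A)) => [|y z ly lz|i _].
- exact: lreg1.
- exact: lregM.
- exact: lreg_1subX.
Qed.

(** Euler's identity at [M = k + 1], multiplied by [(x)_L]. The sum telescopes for [k = 0]; in the
    difference of consecutive [k] a factor [1 - x^j] shifts the index by one. *)
Lemma sum_Xqprod k :
  \sum_(0 <= j < L.+1) x ^+ (k.+1 * j) * qprod x j L = qprod x 0 k.
Proof.
elim: k => [|k IHk].
  rewrite qprod_id; transitivity (qprod x 0 L +
      \sum_(0 <= j < L) (qprod x j.+1 L - qprod x j L)).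
    rewrite big_nat_recl // mul1r; congr (_ + _); apply: eq_big_nat => j /andP[_ jL].
    by rewrite mul1n [qprod x j L]qprodSl //; ring.
  by rewrite telescope_sumr // qprod_id; ring.
rewrite qprodS // -IHk mulrBr mulr1.
rewrite -[LHS](addrK (- \sum_(0 <= j < L.+1) x ^+ (k.+1 * j) * qprod x j L)).
rewrite [LHS]addrC opprK; congr (_ + _).
rewrite -sumrB big_nat_recl // !muln0 subrr add0r.
rewrite mulrC mulr_sumr [in RHS]big_nat_recr //= [X in _ = - (_ + X)]mulrA -exprD.
rewrite [X in _ = - (_ + X * _)]expr_nil ?mul0r ?addr0 -?sumrN; last by nia.
apply: eq_big_nat => j /andP[_ jL].
by rewrite [qprod x j L]qprodSl // !mulSn !mulnS !exprD !exprS; ring.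
Qed.

(* [U_N] times [(x)_L], so that no division occurs: [qprod x r L] stands for
   [(x)_L / (x)_r]. Modulo [x^(L+1)] the truncation at [L] loses nothing. *)
Definition qU (N : nat) : A :=
  \sum_(0 <= r < L) x ^+ (N.+1 * r.+1) * qbin x r N * qprod x r.+1 L.

Lemma qU_small N : (L <= N)%N -> qU N = 0.
Proof.
move=> LN; rewrite /qU big_nat big1 // => r /andP[_ rL].
by rewrite qbin_small ?mulr0 ?mul0r //; lia.
Qed.

(** As [[r, M+1] / (x)_r = 1 / ((x)_(M+1) (x)_(r-M-1))], the substitution [r = M + 1 + j] reduces
    the sum to [sum_Xqprod] at [k = M]. *)
Lemma sum_Xqbin M : 
  (1 - x ^+ M.+1) * (\sum_(0 <= r < L.+1) x ^+ (M.+1 * r) * qbin x r M.+1 * qprod x r L)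
   = x ^+ (M.+1 * M.+1).
Proof.
apply: (qprod_lreg 0 M); rewrite mulrA -qprodS //.
rewrite mulr_sumr.
(* For [M + 1 > L] all the Gaussian binomials and the right-hand side vanish. *)
have [ML|LM] := leqP M.+1 L; last first.
  rewrite big_nat big1 => [|r /andP[_ rL]].
    by rewrite expr_nil ?mulr0 //; nia.
  by rewrite qbin_small ?mulr0 ?mul0r ?mulr0 //; lia.
rewrite (big_cat_nat (n := M.+1)) //=; last lia.
rewrite [X in X + _]big_nat big1 ?add0r => [|r /andP[_ rL]]; last first.
  by rewrite qbin_small ?mulr0 ?mul0r ?mulr0 //.
rewrite -(sum_Xqprod M) mulrC mulr_sumr [RHS](big_cat_nat (n := L.+1 - M.+1)) //=; last lia.
rewrite [X in _ = _ + X]big_nat [X in _ = _ + X]big1 ?addr0 => [|j /andP[Lj _]]; last first.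
  by rewrite mulrA -exprD expr_nil ?mul0r //; nia.
rewrite -{1}[M.+1]add0n big_addn; apply: eq_big_nat => j /andP[_ jL].
rewrite addnC [qprod x j L](qprod_cat _ _ j (M.+1 + j)); [|lia|lia].
have := qbin_qprod A x M.+1 j; rewrite [RHS](qprod_cat _ _ 0 j); [|lia|lia].
rewrite [LHS]mulrC => /qprod_lreg <-.
by rewrite mulnDr exprD; ring.
Qed.

Lemma qU_rec M : qU M + x ^+ M.+1 * qU M.+1 = x ^+ (M.+1 * M.+1) * (1 + x ^+ M.+1).
Proof.
have -> : qU M + x ^+ M.+1 * qU M.+1 = (1 + x ^+ M.+1) *
  ((1 - x ^+ M.+1) *
   (\sum_(0 <= r < L.+1) x ^+ (M.+1 * r) * qbin x r M.+1 * qprod x r L)); last first.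
  by rewrite sum_Xqbin mulrC.
rewrite mulrA [(1 + _) * (1 - _)]mulrC -subr_sqr expr1n -exprM.
(* The first copy of the sum is shifted by one so that Pascal's rule splits [[r+1, M+1]]; in the
   second, [qprod x r L] releases the factor [1 - x^(r+1)]. *)
rewrite mulrBl mul1r [X in X - _]big_nat_recl //.
rewrite qbin_small // mulr0 mul0r add0r.
rewrite big_nat_recr //= mulrDr !mulrA -exprD.
rewrite [X in _ + X * _ * _]expr_nil ?mul0r ?addr0; last first.
  by rewrite -mulnDr mulSn; lia.
rewrite !mulr_sumr /qU -!sumrB -big_split /=.
apply: eq_big_nat => r /andP[_ rL].
rewrite [qprod x r L]qprodSl // (_ : M.+2 * r.+1 = M.+1 * r.+1 + r.+1)%N; last lia.
by rewrite !mulnS !muln0 !addn0 !exprD !exprS; ring.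
Qed.

End Nilpotent.

(** * Telescoping the alternating sums of [U_N] *)

Section NilpotentSums.
Context (A : comNzRingType) (x : A) (L : nat).
Hypothesis xL : x ^+ L.+1 = 0.

(* The pentagonal number [P_(j+1)]; then [P_(-(j+1))] is [pent j + (j+1)]. *)
Definition pent (j : nat) : nat := 'C(j.+1, 2) + j.+1 * j.+1.

Lemma qU_telescope N :
  (-1) ^+ N * x ^+ 'C(N.+1, 2) * qU A x L N -
  (-1) ^+ N.+1 * x ^+ 'C(N.+2, 2) * qU A x L N.+1 =
  (-1) ^+ N * (x ^+ pent N + x ^+ (pent N + N.+1)).
Proof.
have := congr1 ( *%R ((-1) ^+ N * x ^+ 'C(N.+1, 2))) (qU_rec A x L xL N).
rewrite (binS N.+1 1) bin1 /pent !exprD => E.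
by apply: etrans (etrans _ E) _; rewrite ?exprD !exprS; ring.
Qed.

(** Source of the multiplier [m] in (i): the term [f i] lies in the [i + 1] tails that start at some
    [j <= i]. *)
Lemma sum_nested_tail (f : nat -> A) n :
  \sum_(0 <= j < n) \sum_(j <= i < n) f i = \sum_(0 <= j < n) f j *+ j.+1.
Proof.
elim: n => [|n IHn]; first by rewrite !big_geq.
rewrite [RHS]big_nat_recr //= -IHn big_nat_recr //= big_nat1 mulrS addrA.
rewrite [RHS]addrAC; congr (_ + _).
under eq_big_nat => j /andP[_ jn] do rewrite big_nat_recr ?(ltnW jn) //=.
by rewrite big_split /= sumr_const_nat subn0.
Qed.

Lemma qU_tail N : (N <= L)%N ->
  (-1) ^+ N * x ^+ 'C(N.+1, 2) * qU A x L N =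
  \sum_(N <= j < L) (-1) ^+ j * (x ^+ pent j + x ^+ (pent j + j.+1)).
Proof.
move=> NL; under eq_bigr => j _ do rewrite -qU_telescope.
rewrite (telescope_sumr_eq (fun j => - ((-1) ^+ j * x ^+ 'C(j.+1, 2) * qU A x L j))) //.
  by rewrite (qU_small _ _ _ L) // mulr0 oppr0 sub0r opprK.
by move=> i _; rewrite opprK addrC.
Qed.

Lemma sum_qU_le :
  \sum_(0 <= N < L) (-1) ^+ N * x ^+ 'C(N.+1, 2) * qU A x L N =
  \sum_(0 <= j < L) ((-1) ^+ j * (x ^+ pent j + x ^+ (pent j + j.+1))) *+ j.+1.
Proof.
rewrite -sum_nested_tail; apply: eq_big_nat => N /andP[_ NL].
by rewrite qU_tail // ltnW.
Qed.

(** With the weight [x^C(N,2)], [qU_rec] evaluates [w N - x * w N.+1], whence the factor [x - 1].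
    This leaves [x * w 0], where [w 0 = U_0] is the pentagonal series; half of the terms cancel
    because [pent j + 1 = C(j,2) + (j+1)^2 + (j+1)]. *)
Lemma sum_qU_lt :
  (x - 1) * (\sum_(0 <= N < L) (-1) ^+ N * x ^+ 'C(N, 2) * qU A x L N) =
  x * (\sum_(0 <= j < L) (-1) ^+ j * (x ^+ (pent j + j.+1) - x ^+ (3 * 'C(j.+1, 2)))).
Proof.
set w := fun N => (-1) ^+ N * x ^+ 'C(N, 2) * qU A x L N.
have wL : w L = 0 by rewrite /w qU_small // mulr0.
rewrite mulrBl mul1r.
have {1}-> : \sum_(0 <= N < L) w N = w 0 + \sum_(0 <= N < L) w N.+1.
  by rewrite -[RHS]big_nat_recl // big_nat_recr //= wL addr0.
rewrite mulrDr -addrA mulr_sumr -sumrB.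
have -> : w 0 = \sum_(0 <= j < L) (-1) ^+ j * (x ^+ pent j + x ^+ (pent j + j.+1)).
  by rewrite -qU_tail.
rewrite !mulr_sumr -big_split /=; apply: eq_bigr => j _.
have E2 : ('C(j.+2, 2) = 'C(j, 2) + j + j.+1)%N by rewrite (binS j.+1 1) (binS j 1) !bin1; lia.
have := congr1 ( *%R ((-1) ^+ j * x ^+ 'C(j, 2))) (qU_rec A x L xL j).
have -> : (pent j = 'C(j, 2) + j + j.+1 * j.+1)%N by rewrite /pent (binS j 1) bin1.
have T2 : ('C(j, 2) * 2 = j * j.-1)%N by elim: (j) => // k IH; rewrite (binS k 1) bin1; nia.
have E3 : ((3 * 'C(j.+1, 2)).+1 = 'C(j, 2) + j.+1 * j.+1)%N.
  by rewrite (binS j 1) bin1; case: (j) T2 => [|k] //=; nia.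
move=> E; rewrite [RHS]mulrCA [x * (_ - _)]mulrBr -[x * x ^+ (3 * _)]exprS E3.
apply: (addrI ((-1) ^+ j * x ^+ 'C(j, 2) * (qU A x L j + x ^+ j.+1 * qU A x L j.+1))).
by rewrite [in RHS]E /w (binS j 1) bin1 !exprD !exprS; ring.
Qed.

End NilpotentSums.

(** * Partitions by number of parts and least part *)

Lemma count_partitions_size n (Q : pred (seq nat)) (ls : seq (seq nat)) :
  uniq ls -> (forall s, (s \in ls) = int_partition n s && Q s) ->
  count_partitions n Q = size ls.
Proof.
move=> uls lsP; rewrite /count_partitions cardE.
rewrite -(size_map (fun s : {bseq n of 'I_n.+1} => map val s)).
apply/perm_size/uniq_perm => // [|s].
  rewrite map_inj_uniq ?enum_uniq // => s t /(inj_map val_inj) st.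
  exact: val_inj.
rewrite lsP; apply/mapP/idP => [[t]|/[dup] /andP[/int_partition_repr[t <-] _] tP].
  by rewrite mem_enum inE => tP ->.
by exists t; rewrite // mem_enum inE.
Qed.

(** Partitions in an [a] by [b] box, raised by [lo]; the excess [c] of the head bounds the rest,
    which keeps the list decreasing. *)
Fixpoint box (lo a b : nat) : seq (seq nat) :=
  if a is a'.+1 then
    [seq (lo + c)%N :: s | c <- iota 0 b.+1, s <- box lo a' c]
  else [:: [::]].

Lemma boxS lo a b :
  box lo a.+1 b = [seq (lo + c)%N :: s | c <- iota 0 b.+1, s <- box lo a c].
Proof. by []. Qed.

Lemma mem_box lo a b (s : seq nat) :
  (s \in box lo a b) = [&& size s == a, path geq (lo + b)%N s & all (leq lo) s].
Proof.
elim: a b s => [|a IHa] b [|y s] //; rewrite boxS; first by apply/allpairsPdep => -[? [? []]].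
apply/allpairsPdep/and3P => [[c [t]]|[/= sa /andP[yb ys] /andP[loy los]]].
  rewrite mem_iota IHa /= => -[cb /and3P[ta tc tlo] [-> ->]].
  by split; rewrite //= ?ta ?tc ?tlo ?leq_addr ?andbT // /geq /= leq_add2l -ltnS.
exists (y - lo)%N, s; split; last by rewrite subnKC.
  by rewrite inE mem_iota; rewrite /geq /= in yb; lia.
by rewrite IHa subnKC // los ys -eqSS sa.
Qed.

Lemma box_uniq lo a b : uniq (box lo a b).
Proof.
elim: a b => [|a IHa] b //; rewrite boxS; apply: allpairs_uniq_dep => [|c _|];
  rewrite ?iota_uniq //.
by move=> [c s] [d t] _ _ /= [/addnI <- <-].
Qed.

(** Box partitions are enumerated by [[a+b, a]], here cleared of denominators. The inner induction
    on [b] adds those with largest part exactly [lo + b + 1]. *)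
Lemma qprod_box (A : comNzRingType) (x : A) lo a b :
  qprod x 0 a * (\sum_(s <- box lo a b) x ^+ sumn s) =
  x ^+ (lo * a) * qprod x b (a + b).
Proof.
elim: a b => [|a IHa] b.
  by rewrite /= big_seq1 !qprod_id muln0.
rewrite boxS big_allpairs_dep.
have -> : \sum_(c <- iota 0 b.+1) \sum_(s <- box lo a c) x ^+ sumn (lo + c :: s)%N =
    \sum_(0 <= c < b.+1) x ^+ (lo + c) * (\sum_(s <- box lo a c) x ^+ sumn s).
  rewrite /index_iota subn0; apply: eq_bigr => c _; rewrite mulr_sumr.
  by apply: eq_bigr => s _; rewrite -exprD.
elim: b => [|b IHb].
  rewrite big_nat1 mulrCA qprodS // mulrAC IHa !addn0.
  by rewrite qprodS // mulnS exprD; ring.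
rewrite big_nat_recr //= mulrDr IHb mulrCA (qprodS _ _ 0 a) // mulrAC IHa.
rewrite -[(a + b.+1)%N]addSnnS [(a.+1 + b.+1)%N]addnS.
rewrite [qprod x b _]qprodSl; last by lia.
rewrite [qprod x b.+1 _.+1]qprodS; last by lia.
by rewrite mulnS !addSn addnS !exprS !exprD; ring.
Qed.

(* Partitions with [r + 1 <= L] parts, least part [l <= L] and largest part at
   most [l + b r]. *)
Definition kparts (L : nat) (b : nat -> nat) : seq (seq nat) :=
  [seq rcons s rl.2 | rl <- [seq (r, l) | r <- iota 0 L, l <- iota 1 L],
                      s <- box rl.2 rl.1 (b rl.1)].

Lemma kparts_uniq L b : uniq (kparts L b).
Proof.
apply: allpairs_uniq_dep => [|rl _|]; [|exact: box_uniq|].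
  by apply: allpairs_uniq; rewrite ?iota_uniq // => -[? ?] [].
set st := [seq _ | _ <- _, _ <- _].
have szst p : p \in st -> size (tagged p) = (tag p).1.
  by case/allpairsPdep => rl [s [_ + ->]] /=; rewrite mem_box => /and3P[/eqP].
move=> [[r l] s] [[r' l'] s'] /szst /= <- /szst /= <-.
by move=> /rcons_inj[-> ->].
Qed.

Lemma path_geq_rcons m (s : seq nat) l : (l <= m)%N ->
  path geq m (rcons s l) = path geq m s && all (leq l) s.
Proof.
elim: s m => [|y s IHs] m lm /=; first by rewrite /geq /= lm.
have [ly|yl] := leqP l y; first by rewrite IHs // andbA.
rewrite /= andbF; apply/negP => /andP[_].
have geq_trans : transitive geq by move=> a b c /= ba ac; exact: leq_trans ac ba.
move=> /(order_path_min geq_trans) /allP /(_ l).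
by rewrite mem_rcons mem_head /geq /= leqNgt yl => /(_ isT).
Qed.

Lemma size_le_sumn (s : seq nat) : 0%N \notin s -> (size s <= sumn s)%N.
Proof.
elim: s => //= y s IHs; rewrite inE negb_or eq_sym -lt0n => /andP[y0 /IHs].
by rewrite -add1n; exact: leq_add.
Qed.

(** The bounds by [L] built into [kparts] are automatic here: a partition of [n] has at most [n]
    parts, each at most [n]. *)
Lemma mem_kparts L b n t : (0 < n <= L)%N ->
  (t \in kparts L b) && (sumn t == n) =
  int_partition n t && (head 0 t <= last 0 t + b (size t).-1)%N.
Proof.
move=> nL; have [sn|] := eqVneq (sumn t) n; last first.
  by rewrite /int_partition => /negPf->; rewrite !andbF.
rewrite andbT /int_partition sn eqxx andbT.
case: (lastP t) sn => [|s l] sn; first by move: nL; rewrite -sn.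
rewrite size_rcons last_rcons /=.
have -> : (rcons s l \in kparts L b) =
    [&& (size s < L)%N, (0 < l <= L)%N & s \in box l (size s) (b (size s))].
  apply/allpairsPdep/and3P => [[rl [s' [/allpairsP[[r1 l1] /= [+ + ->]]]]]|[sL lL sb]].
    rewrite !mem_iota mem_box => r1L l1L /and3P[/eqP sr ps al] /rcons_inj[-> ->].
    by rewrite /= in sr ps al *; rewrite sr; split; [lia | lia | rewrite mem_box sr eqxx ps al].
  exists (size s, l), s; split => //; apply/allpairsP; exists (size s, l).
  by rewrite /= !mem_iota.
rewrite mem_box eqxx -path_geq_rcons ?leq_addr //=.
have -> m : path geq m (rcons s l) = (head 0 (rcons s l) <= m)%N && sorted geq (rcons s l).
  by case: (s).
have [ss|] := boolP (sorted geq _); last by rewrite !andbF.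
rewrite /= !andbT !andbA; congr (_ && _).
have al : all (leq l) (rcons s l).
  have := path_geq_rcons (l + head 0 (rcons s l)) s l (leq_addr _ _).
  rewrite all_rcons leqnn /=; case: (s) ss => //= y s' ->.
  by rewrite leq_addl => /esym E; case/andP: E.
apply/andP/idP => [[/andP[sL l0] lL]|s0].
  by apply/negP => /(allP al); rewrite leqNgt l0.
have := size_le_sumn _ s0; have := sumn_rcons s l; rewrite sn size_rcons => ns ls.
have l0 : (0 < l)%N by move: s0; rewrite mem_rcons inE negb_or eq_sym -lt0n => /andP[].
by rewrite l0 andbT; split; lia.
Qed.

(** * Generating functions of the lists of partitions *)

Section NilpotentKparts.
Context (A : comNzRingType) (x : A) (L : nat).
Hypothesis xL : x ^+ L.+1 = 0.

Lemma geometric_nil k : (0 < k)%N ->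
  (1 - x ^+ k) * (\sum_(1 <= l < L.+1) x ^+ (k * l)) = x ^+ k.
Proof.
move=> k0; rewrite big_add1 /= mulrBl mul1r mulr_sumr -sumrB.
rewrite (telescope_sumr_eq (fun l => - x ^+ (k * l.+1))) // => [|l _].
  by rewrite (expr_nil A x L xL (k * L.+1)) ?oppr0 ?add0r ?opprK ?muln1 // leq_pmull.
by rewrite opprK -exprD -mulnS addrC.
Qed.

(** Summing over the least part gives [x^(r+1) / (1 - x^(r+1))], whose denominator completes the
    [(x)_r] of the box to [(x)_(r+1)]. *)
Lemma qprod_kparts b :
  qprod x 0 L * (\sum_(t <- kparts L b) x ^+ sumn t) =
  \sum_(0 <= r < L) x ^+ r.+1 * qprod x r.+1 L * qprod x (b r) (r + b r).
Proof.
have -> : kparts L b = [seq rcons s rl.2 | rl <- [seq (r, l) | r <- index_iota 0 L,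
    l <- index_iota 1 L.+1], s <- box rl.2 rl.1 (b rl.1)].
  by rewrite /index_iota subn0 subn1.
rewrite big_allpairs_dep big_allpairs mulr_sumr; apply: eq_big_nat => r /andP[_ rL] /=.
rewrite (qprod_cat _ _ 0 r.+1 L) // qprodS //.
have -> : \sum_(1 <= l < L.+1) \sum_(s <- box l r (b r)) x ^+ sumn (rcons s l) =
  \sum_(1 <= l < L.+1) x ^+ l * (\sum_(s <- box l r (b r)) x ^+ sumn s).
  apply: eq_bigr => l _; rewrite mulr_sumr.
  by apply: eq_bigr => s _; rewrite sumn_rcons addnC exprD.
have E : qprod x 0 r * (1 - x ^+ r.+1) *
    (\sum_(1 <= l < L.+1) x ^+ l * (\sum_(s <- box l r (b r)) x ^+ sumn s)) =
    x ^+ r.+1 * qprod x (b r) (r + b r).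
  rewrite -[x ^+ r.+1 in RHS]geometric_nil // mulrAC mulrC -mulrA; congr (_ * _).
  rewrite mulr_sumr mulr_suml; apply: eq_bigr => l _.
  by rewrite mulrCA qprod_box mulrA -exprD mulSn mulnC.
by rewrite mulrAC E mulrAC.
Qed.

(** The q-binomial theorem at [z = x^(m+1)]. Zero terms extend the range to [L], independent of [r],
    so that sums can be exchanged. *)
Lemma qprod_shift m r : (r < L)%N ->
  qprod x m (r + m) =
  \sum_(0 <= k < L) (-1) ^+ k * x ^+ 'C(k, 2) * qbin x r k * x ^+ (m.+1 * k).
Proof.
move=> rL; rewrite (big_cat_nat (n := r.+1)) //= [X in _ + X]big_nat.
rewrite [X in _ + X]big1 ?addr0 => [|k /andP[rk _]]; last first.
  by rewrite qbin_small // mulr0 mul0r.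
under eq_bigr => k _ do rewrite exprM.
rewrite -qbinomial /qprod -{1}[m]add0n big_addn addnK.
by apply: eq_bigr => i _; rewrite -exprD addnC -addSn.
Qed.

Lemma qprod_kparts_shift e :
  qprod x 0 L * (\sum_(t <- kparts L (fun r => r + e)%N) x ^+ sumn t) =
  \sum_(0 <= N < L) (-1) ^+ N * x ^+ ('C(N, 2) + e * N) * qU A x L N.
Proof.
rewrite qprod_kparts.
under eq_big_nat => r /andP[_ rL] do rewrite qprod_shift // mulr_sumr.
rewrite exchange_big_nat /=; apply: eq_bigr => N _; rewrite /qU mulr_sumr.
apply: eq_bigr => r _.
have -> : ((r + e).+1 * N = e * N + r.+1 * N)%N by lia.
by rewrite [(N.+1 * _)%N]mulSn [(N * _)%N]mulnC !exprD; ring.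
Qed.

(** Under the bound [L] the box numerators are 1 modulo [x^(L+1)], which leaves only [U_0]. *)
Lemma qprod_kparts_all :
  qprod x 0 L * (\sum_(t <- kparts L (fun=> L)) x ^+ sumn t) = qU A x L 0.
Proof.
rewrite qprod_kparts; apply: eq_big_nat => r /andP[_ rL].
rewrite qbin0 mulr1 mul1n [qprod x L _]big_nat [X in _ * X]big1 ?mulr1 // => i /andP[Li _].
by rewrite (expr_nil A x L xL) ?subr0.
Qed.

(** The summand 1 is the empty partition; it is also the term [j = 0] of Euler's identity at
    [M = 1], up to the factor [(x)_L]. *)
Lemma qprod_partitions :
  qprod x 0 L * (1 + \sum_(t <- kparts L (fun=> L)) x ^+ sumn t) = 1.
Proof.
rewrite mulrDr qprod_kparts_all mulr1 -(qprod_id A x 0) -(sum_Xqprod A x L xL 0).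
rewrite big_nat_recl // muln0 mul1r; congr (_ + _); apply: eq_bigr => r _.
by rewrite qbin0 mulr1 mul1n.
Qed.

End NilpotentKparts.

(** * Generating functions and their convolution with sigma *)

(** The class of ['X] is the nilpotent element to which the preceding identities are applied. *)
Definition trunc (L : nat) : {poly int} -> {poly %/ ('X^(L.+1) : {poly int})} :=
  in_qpoly 'X^(L.+1).

HB.instance Definition _ (L : nat) :=
  GRing.RMorphism.copy (trunc L) (in_qpoly ('X^(L.+1) : {poly int})).

Section Truncation.
Context (L : nat).
Notation D := (qprod ('X : {poly int}) 0 L).

Lemma truncXn : trunc L 'X ^+ L.+1 = 0.
Proof.
rewrite -rmorphXn /=; apply/val_inj => /=.
rewrite mk_monic_Xn Pdiv.RingMonic.rmodpp //; exact: monicXn.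
Qed.

Lemma truncP p q : trunc L p = trunc L q <-> forall i, (i <= L)%N -> p`_i = q`_i.
Proof.
have trunc_take r : trunc L r = trunc L (take_poly L.+1 r).
  rewrite -[in LHS](poly_take_drop L.+1 r) rmorphD rmorphM rmorphXn /=.
  by rewrite truncXn mulr0 addr0.
split=> [|pq]; last first.
  rewrite trunc_take [RHS]trunc_take; congr trunc; apply/polyP => i.
  by rewrite !coef_take_poly ltnS; case: leqP => // /pq.
rewrite trunc_take [RHS]trunc_take => /(congr1 val) /=.
rewrite mk_monic_Xn !Pdiv.CommonRing.rmodp_small ?size_polyXn ?ltnS ?size_take_poly //.
move=> E i iL.
by move/polyP/(_ i): E; rewrite !coef_take_poly ltnS iL.
Qed.

Lemma trunc_qprod m n : trunc L (qprod 'X m n) = qprod (trunc L 'X) m n.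
Proof.
rewrite /qprod rmorph_prod; apply: eq_bigr => i _.
by rewrite rmorphB rmorph1 rmorphXn.
Qed.

(** Unlike the bare derivative, [X d/dX] preserves degrees and so descends to the quotient. *)
Lemma trunc_Xderiv p q : trunc L p = trunc L q -> trunc L ('X * p^`()) = trunc L ('X * q^`()).
Proof.
move=> /truncP pq; apply/truncP => -[|i] iL; rewrite !coefXM //= !coef_deriv.
by rewrite pq.
Qed.

Definition kpoly (b : nat -> nat) : {poly int} := \sum_(t <- kparts L b) 'X^(sumn t).

Lemma trunc_kpoly b : trunc L (kpoly b) = \sum_(t <- kparts L b) trunc L 'X ^+ sumn t.
Proof. by rewrite /kpoly rmorph_sum; apply: eq_bigr => t _; rewrite rmorphXn. Qed.

Lemma coef_kpoly b n (Q : pred (seq nat)) : (0 < n <= L)%N ->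
  (forall t, int_partition n t -> Q t = (head 0 t <= last 0 t + b (size t).-1)%N) ->
  (kpoly b)`_n = count_partitions n Q.
Proof.
move=> nL QE; rewrite (count_partitions_size n Q [seq t <- kparts L b | sumn t == n]).
- rewrite /kpoly coef_sum size_filter -sum1_count -[RHS]natz natr_sum [RHS]big_mkcond /=.
  by apply: eq_bigr => t _; rewrite coefXn eq_sym; case: eqP.
- by rewrite filter_uniq // kparts_uniq.
- move=> t; rewrite mem_filter andbC mem_kparts //.
  by have [/QE->|] := boolP (int_partition n t).
Qed.

Lemma coef0_kpoly b : (kpoly b)`_0 = 0.
Proof.
rewrite /kpoly coef_sum big_seq big1 // => t /allpairsPdep[rl [s [rlP _ ->]]].
rewrite coefXn; case/allpairsP: rlP => -[r l] /= [_ + ->].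
by rewrite mem_iota sumn_rcons /= => /andP[l0 _]; rewrite -(prednK l0) addnS.
Qed.

Lemma kimberling_le0 t : (kimberling t <= 0) = (head 0 t <= last 0 t + size t)%N.
Proof.
by rewrite /kimberling -addrA -opprD subr_le0 -PoszD lez_nat.
Qed.

Lemma size_partition n t : (0 < n)%N -> int_partition n t -> (0 < size t)%N.
Proof. by case: t; case: n => // n _ /and3P[]. Qed.

(** Index [r] means [r + 1] parts, so [K <= 0] bounds the largest part minus the least by [r + 1];
    likewise [K < 0] bounds it by [r]. *)
Lemma coef_Kle n : (0 < n <= L)%N -> (kpoly (fun r => r + 1)%N)`_n = Kle n.
Proof.
move=> nL; apply: coef_kpoly => // t /size_partition tn.
by rewrite kimberling_le0 addn1 prednK //; apply: tn; lia.
Qed.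

Lemma coef_Klt n : (0 < n <= L)%N -> (kpoly (fun r => r + 0)%N)`_n = Klt n.
Proof.
move=> nL; apply: coef_kpoly => // t /size_partition tn.
rewrite /kimberling -addrA -opprD subr_lt0 -PoszD ltz_nat addn0.
by case: size tn => [/(_ (andP nL).1) //|k _]; rewrite addnS.
Qed.

Definition ppoly : {poly int} := 1 + kpoly (fun=> L).

Lemma coef_ppoly n : (n <= L)%N -> ppoly`_n = p n.
Proof.
rewrite /ppoly coefD coef1; case: n => [|n] nL; last first.
  rewrite add0r /p; apply: coef_kpoly => // t /and3P[_ _ /eqP tn].
  apply/esym; apply: leq_trans (leq_addl _ _); apply: leq_trans nL; rewrite -tn.
  by case: (t) => //= y s; exact: leq_addr.
rewrite coef0_kpoly addr0 /p (count_partitions_size 0 xpredT [:: [::]]) // => s.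
rewrite inE /int_partition andbT; case: s => // y s; apply/esym/negbTE.
rewrite inE negb_or; case: y => [|y]; first by rewrite /= andbF.
by rewrite /= addSn !andbF.
Qed.

Lemma count_partitionsC n (Q : pred (seq nat)) :
  count_partitions n xpredT =
  (count_partitions n Q + count_partitions n (predC Q))%N.
Proof.
rewrite /count_partitions -(cardsID [set s : {bseq n of 'I_n.+1} | Q (map val s)]).
by congr (_ + _)%N; apply: eq_card => s; rewrite !inE andbT // andbC.
Qed.

Lemma Kgt_Kle n : (Kgt n)%:Z = (p n)%:Z - (Kle n)%:Z.
Proof.
rewrite /p (count_partitionsC n (fun s => kimberling s <= 0)) PoszD addrC addKr.
congr Posz; apply: eq_card => s.
by rewrite !inE /= -ltNge.
Qed.

(** The Lambert series [sum_i i X^i / (1 - X^i)], truncated. *)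
Definition spoly : {poly int} :=
  \sum_(0 <= i < L) \sum_(1 <= j < L.+1) i.+1%:R * 'X^(i.+1 * j).

Lemma coef_spoly m : (0 < m <= L)%N -> spoly`_m = sigma m.
Proof.
move=> mL; rewrite /sigma.
have dP : perm_eq (divisors m) [seq i <- index_iota 1 L.+1 | (i %| m)%N].
  apply: uniq_perm => [||i]; rewrite ?divisors_uniq ?filter_uniq ?iota_uniq //.
  rewrite -dvdn_divisors ?mem_filter ?mem_index_iota; last by lia.
  have [im|] := boolP (i %| m)%N => //=; apply/esym/andP.
  have m0 : (0 < m)%N by lia.
  by split; [exact: dvdn_gt0 im | have := dvdn_leq m0 im; lia].
rewrite (perm_big _ dP) big_filter big_mkcond big_add1 /= /spoly.
rewrite coef_sum -[RHS]natz natr_sum; apply: eq_bigr => i _; rewrite coef_sum.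
have E j : (i.+1%:R * 'X^(i.+1 * j) : {poly int})`_m =
    (if (i.+1 * j == m)%N then i.+1%:R else 0).
  by rewrite -polyC_natr coefCM coefXn eq_sym; case: eqP; rewrite ?mulr1 ?mulr0.
under eq_bigr => j _ do rewrite E.
have [/dvdnP[k mk]|im] := boolP (i.+1 %| m)%N; last first.
  rewrite big1 // => j _; case: eqP => // mj.
  by case/negP: im; rewrite -mj dvdn_mulr.
have kL : k \in index_iota 1 L.+1 by rewrite mem_index_iota; nia.
rewrite (bigD1_seq k) ?iota_uniq //= mk mulnC eqxx big1 ?addr0 // => j jk.
by rewrite [(k * _)%N]mulnC eqn_pmul2l // (negPf jk).
Qed.

Lemma coef0_spoly : spoly`_0 = 0.
Proof.
rewrite /spoly coef_sum big1 // => i _; rewrite coef_sum big_nat big1 // => j /andP[j0 _].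
by rewrite -polyC_natr coefCM coefXn -(prednK j0) mulr0.
Qed.

(** The logarithmic derivative by [X d/dX] of each factor [1 - X^i] is [- i X^i / (1 - X^i)], minus
    a Lambert term; the product rule adds these up. *)
Lemma trunc_log_deriv : trunc L (D * spoly) = - trunc L ('X * D^`()).
Proof.
set x := trunc L 'X.
rewrite /spoly; suff: forall n, (n <= L)%N -> trunc L (qprod 'X 0 n *
    \sum_(0 <= i < n) \sum_(1 <= j < L.+1) i.+1%:R * 'X^(i.+1 * j)) =
    - trunc L ('X * (qprod 'X 0 n)^`()) by apply.
elim=> [|n IHn] nL.
  by rewrite qprod_id big_geq // -polyC1 derivC !mulr0 rmorph0 oppr0.
rewrite qprodS // big_nat_recr //=; set q := qprod _ 0 n; set s := \sum_(0 <= i < n) _.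
have -> : q * (1 - 'X^(n.+1)) * (s + \sum_(1 <= j < L.+1) n.+1%:R * 'X^(n.+1 * j)) =
  (1 - 'X^(n.+1)) * (q * s) +
  n.+1%:R * q * ((1 - 'X^(n.+1)) * (\sum_(1 <= j < L.+1) 'X^(n.+1 * j))).
  by rewrite -mulr_sumr; ring.
have -> : 'X * (q * (1 - 'X^(n.+1)))^`() =
    (1 - 'X^(n.+1)) * ('X * q^`()) - n.+1%:R * q * 'X^(n.+1).
  rewrite derivM derivB derivC sub0r derivXn /= exprS -mulr_natl; ring.
have G : trunc L ((1 - 'X^(n.+1)) * (\sum_(1 <= j < L.+1) 'X^(n.+1 * j))) = trunc L 'X^(n.+1).
  rewrite rmorphM rmorphB rmorph1 rmorph_sum !rmorphXn -[RHS](geometric_nil _ x L truncXn) //.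
  by congr (_ * _); apply: eq_bigr => j _; rewrite rmorphXn.
move: (IHn (ltnW nL)) G; rewrite !rmorphD !rmorphM rmorphN rmorphM => -> ->.
rewrite !rmorphM; ring.
Qed.

(** Here [xD] and [xP] stand for [X D'] and [X P']. The hypotheses give [xP = P * s], and
    [d * P = 1] does the rest. *)
Lemma log_deriv_solve (A : comNzRingType) (xD xP d P F s : A) :
  d * P = 1 -> d * s = - xD -> xD * P + d * xP = 0 -> F * s = d * F * xP.
Proof.
move=> dP ds E.
have -> : xP = P * s.
  rewrite -[xP]mul1r -dP -[RHS]mul1r -dP; apply/eqP; rewrite -subr_eq0; apply/eqP.
  transitivity (P * (xD * P + d * xP) - P * P * (d * s + xD)); first by ring.
  by rewrite E ds addNr !mulr0 subr0.
transitivity (d * P * (F * s)); last by ring.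
by rewrite dP mul1r.
Qed.

Lemma trunc_convolution_spoly f b : trunc L (D * f) = trunc L b ->
  trunc L (f * spoly) = trunc L (b * ('X * ppoly^`())).
Proof.
move=> Df.
have DP : trunc L D * trunc L ppoly = 1.
  by rewrite trunc_qprod /ppoly rmorphD rmorph1 /= trunc_kpoly qprod_partitions // truncXn.
(* Applying [X d/dX] to [D * ppoly = 1] yields the last hypothesis of [log_deriv_solve]. *)
have := trunc_Xderiv (D * ppoly) 1; rewrite rmorphM rmorph1 => /(_ DP).
rewrite -polyC1 derivC mulr0 rmorph0 derivM mulrDr [_ * (_ * ppoly)]mulrA [_ * (D * _)]mulrCA.
have := trunc_log_deriv; rewrite rmorphD !rmorphM /= => ds.
move: Df DP ds; rewrite !rmorphM /=.
move: (trunc L D) (trunc L ppoly) (trunc L f) (trunc L b) (trunc L spoly).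
move: (trunc L 'X * trunc L D^`()) (trunc L 'X * trunc L ppoly^`()).
move=> xD xP d P F B s <- dP ds E.
exact: (log_deriv_solve _ xD xP d P F s dP ds E).
Qed.

End Truncation.

(** * Convolutions with [sigma] as explicit sums *)

Section KimberlingConvolution.
Context (L : nat).
Notation D := (qprod ('X : {poly int}) 0 L).

Lemma coef_XnM_Xderiv_ppoly n e : (n <= L)%N ->
  ('X^e * ('X * (ppoly L)^`()))`_n =
  (n%:Z - e%:Z) * (p (n%:Z - e%:Z))%:Z.
Proof.
move=> nL; rewrite coefXnM; case: leqP => [en|ne]; last first.
  have -> : n%:Z - e%:Z = Negz (e - n).-1 by rewrite NegzE; lia.
  by rewrite mulr0.
rewrite subzn // coefXM; case E : (n - e)%N => [|k]; first by rewrite mul0r.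
rewrite coef_deriv coef_ppoly; last by lia.
by rewrite -[LHS]mulr_natl natz.
Qed.

Lemma trunc_sign_sum (f : nat -> {poly int}) :
  trunc L (\sum_(0 <= j < L) (-1) ^+ j * f j) = \sum_(0 <= j < L) (-1) ^+ j * trunc L (f j).
Proof. by rewrite rmorph_sum; apply: eq_bigr => j _; rewrite rmorphM rmorphXn rmorphN1. Qed.

Lemma trunc_kpoly_le :
  trunc L (D * kpoly L (fun r => r + 1)%N) =
  trunc L (\sum_(0 <= j < L) (-1) ^+ j * (('X^(pent j) + 'X^(pent j + j.+1)) *+ j.+1)).
Proof.
rewrite rmorphM /= trunc_qprod trunc_kpoly qprod_kparts_shift ?truncXn // trunc_sign_sum.
have binS2 N : ('C(N, 2) + 1 * N = 'C(N.+1, 2))%N by rewrite binS bin1 mul1n.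
under eq_bigr => N _ do rewrite binS2.
rewrite sum_qU_le ?truncXn //; apply: eq_bigr => j _.
by rewrite rmorphMn rmorphD !rmorphXn mulrnAr.
Qed.

(** The pentagonal number theorem, since the left side is [1 - D] modulo [X^(L+1)]. *)
Lemma trunc_kpoly_all :
  trunc L (D * kpoly L (fun=> L)) =
  trunc L (\sum_(0 <= j < L) (-1) ^+ j * ('X^(pent j) + 'X^(pent j + j.+1))).
Proof.
rewrite rmorphM /= trunc_qprod trunc_kpoly qprod_kparts_all ?truncXn // trunc_sign_sum.
have := qU_tail _ _ _ (truncXn L) 0 (leq0n L); rewrite !mul1r => ->.
by apply: eq_bigr => j _; rewrite rmorphD !rmorphXn.
Qed.

Lemma trunc_kpoly_lt :
  trunc L (D * (('X - 1) * kpoly L (fun r => r + 0)%N)) =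
  trunc L ('X * (\sum_(0 <= j < L)
    (-1) ^+ j * ('X^(pent j + j.+1) - 'X^(3 * 'C(j.+1, 2))))).
Proof.
rewrite mulrCA !rmorphM /= trunc_qprod trunc_kpoly.
rewrite qprod_kparts_shift ?truncXn // trunc_sign_sum.
under eq_bigr => N _ do rewrite mul0n addn0.
rewrite rmorphB rmorph1 sum_qU_lt ?truncXn //; congr (_ * _); apply: eq_bigr => j _.
by rewrite rmorphB !rmorphXn.
Qed.

Lemma coef_kpoly_spoly b (K : nat -> nat) n :
  (forall k, (0 < k <= L)%N -> (kpoly L b)`_k = K k) -> (0 < n <= L)%N ->
  (kpoly L b * spoly L)`_n = \sum_(1 <= m < n) (K (n - m)%N)%:Z * (sigma m)%:Z.
Proof.
move=> KE /andP[n0 nL]; rewrite coefMr.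
rewrite -(big_mkord xpredT (fun j => (kpoly L b)`_(n - j) * (spoly L)`_j)).
rewrite big_nat_recr //= subnn coef0_kpoly mul0r addr0 big_ltn // coef0_spoly mulr0 add0r.
apply: eq_big_nat => m /andP[m0 mn]; rewrite KE ?coef_spoly //; lia.
Qed.

Lemma coef_convolution_spoly f b n : trunc L (D * f) = trunc L b -> (n <= L)%N ->
  (f * spoly L)`_n = (b * ('X * (ppoly L)^`()))`_n.
Proof. by move=> /trunc_convolution_spoly /truncP; apply. Qed.

End KimberlingConvolution.

Lemma coef_signM (q : {poly int}) j n : ((-1) ^+ j * q)`_n = (-1) ^+ j * q`_n.
Proof.
rewrite -(signr_odd _ j) -[in RHS](signr_odd _ j).
by case: odd; rewrite ?mulN1r ?mul1r ?coefN.
Qed.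

Definition np (n : nat) (e : int) : int := (n%:Z - e) * (p (n%:Z - e))%:Z.

Lemma sum_Kle_sigma n : (0 < n)%N ->
  \sum_(1 <= m < n) (Kle (n - m))%:Z * (sigma m)%:Z =
  \sum_(0 <= j < n.+1) (-1) ^+ j * (np n (pent j) + np n (pent j + j.+1)%N) * j.+1%:Z.
Proof.
move=> n0; rewrite -(coef_kpoly_spoly n.+1 _ _ _ (@coef_Kle n.+1)); last by rewrite n0 /=.
rewrite (coef_convolution_spoly _ _ _ _ (trunc_kpoly_le _)) // mulr_suml coef_sum.
apply: eq_bigr => j _; rewrite /np -!(coef_XnM_Xderiv_ppoly n.+1) //.
rewrite mulrnAr mulrnAl coefMn -mulr_natr natz; congr (_ * _).
by rewrite -mulrA coef_signM mulrDl coefD.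
Qed.

Lemma sum_p_sigma n : (0 < n)%N ->
  \sum_(1 <= m < n) (p (n - m)%N)%:Z * (sigma m)%:Z =
  \sum_(0 <= j < n.+1) (-1) ^+ j * (np n (pent j) + np n (pent j + j.+1)%N).
Proof.
move=> n0; rewrite -(coef_kpoly_spoly n.+1 (fun=> n.+1) (fun k => p k)); last 2 first.
- by move=> [//|k] kL; rewrite -(coef_ppoly n.+1) // /ppoly coefD coef1 add0r.
- by rewrite n0 /=.
rewrite (coef_convolution_spoly _ _ _ _ (trunc_kpoly_all _)) // mulr_suml coef_sum.
apply: eq_bigr => j _; rewrite /np -!(coef_XnM_Xderiv_ppoly n.+1) //.
by rewrite -mulrA coef_signM mulrDl coefD.
Qed.

Lemma sum_Klt_sigma n : (0 < n)%N ->
  \sum_(1 <= m < n) (Klt (n - m))%:Z * (sigma m)%:Z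
  - \sum_(1 <= m < n.+1) (Klt (n - m + 1))%:Z * (sigma m)%:Z =
  \sum_(0 <= j < n.+1) (-1) ^+ j * (np n (pent j + j.+1)%N - np n (3 * 'C(j.+1, 2))%N).
Proof.
move=> n0.
have -> : \sum_(1 <= m < n.+1) (Klt (n - m + 1))%:Z * (sigma m)%:Z =
    \sum_(1 <= m < n.+1) (Klt (n.+1 - m))%:Z * (sigma m)%:Z.
  by apply: eq_big_nat => m /andP[_ mn]; rewrite addn1 subSn.
(* The second sum is a coefficient of index [n + 1], hence the truncation order [n + 1]. *)
rewrite -!(coef_kpoly_spoly n.+1 _ _ _ (@coef_Klt n.+1)) ?leqnn ?leqW ?n0 //.
have := coef_convolution_spoly _ _ _ n.+1 (trunc_kpoly_lt n.+1) (leqnn _).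
rewrite -!mulrA mulrBl mul1r coefB !coefXM /= => ->.
rewrite mulr_suml coef_sum.
apply: eq_bigr => j _; rewrite /np -!(coef_XnM_Xderiv_ppoly n.+1) //.
by rewrite -mulrA coef_signM mulrBl coefB.
Qed.

(** * The ranges of summation *)

Lemma pent_double j : (2 * pent j = j.+1 * (3 * j + 2))%N.
Proof. by rewrite /pent; elim: j => // j IHj; rewrite (binS j.+1 1) bin1; nia. Qed.

Lemma P_pos j : P j.+1%:Z = pent j.
Proof.
rewrite /P; have -> : j.+1%:Z * (3 * j.+1%:Z - 1) = (pent j)%:Z * 2.
  by have := pent_double j; nia.
by rewrite mulzK.
Qed.

Lemma P_neg j : P (- j.+1%:Z) = (pent j + j.+1)%N.
Proof.
rewrite /P; have -> : - j.+1%:Z * (3 * - j.+1%:Z - 1) = (pent j + j.+1)%N%:Z * 2.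
  by have := pent_double j; nia.
by rewrite mulzK.
Qed.

Lemma T_bin j : T j = 'C(j.+1, 2).
Proof. by rewrite /T addn1 mulnC bin2 /= divn2. Qed.

(** The first hypothesis removes the absolute value; the second makes [6 m - a] nonnegative, so that
    squaring is reversible. *)
Lemma ceil_sqrt_le (R : realType) (a d : R) m : 0 <= a + Num.sqrt d -> a <= 6 * m%:R ->
  (`|Num.ceil ((a + Num.sqrt d) / 6)| <= m)%N = (d <= (6 * m%:R - a) ^+ 2).
Proof.
move=> ad am.
have c0 : 0 <= Num.ceil ((a + Num.sqrt d) / 6) by rewrite ceil_ge0; lra.
rewrite -lez_nat gez0_abs // ceil_le_int ler_pdivrMr // -lerBrDl.
have m0 : 0 <= 6 * m%:R - a by lra.
rewrite (_ : m%:~R * 6 - a = Num.sqrt ((6 * m%:R - a) ^+ 2)).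
  by rewrite ler_sqrt // sqr_ge0.
by rewrite sqrtr_sqr ger0_norm // mulrC.
Qed.

Lemma floor_sqrt_lt (R : realType) (a d : R) m : 0 <= a + Num.sqrt d -> a <= 6 * m%:R ->
  0 <= d ->
  (`|Num.floor ((a + Num.sqrt d) / 6)| < m)%N = (d < (6 * m%:R - a) ^+ 2).
Proof.
move=> ad am d0.
have c0 : 0 <= Num.floor ((a + Num.sqrt d) / 6) by rewrite floor_ge_int mulr0z; lra.
rewrite -ltz_nat gez0_abs // floor_lt_int ltr_pdivrMr // -ltrBrDl.
have m0 : 0 <= 6 * m%:R - a by lra.
rewrite (_ : m%:~R * 6 - a = Num.sqrt ((6 * m%:R - a) ^+ 2)).
  by rewrite !ltNge ler_sqrt.
by rewrite sqrtr_sqr ger0_norm // mulrC.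
Qed.

Lemma pentE (R : realType) j : (pent j)%:R = (j%:R + 1) * (3 * j%:R + 2) / 2 :> R.
Proof.
have := congr1 (fun k => k%:R : R) (pent_double j).
by rewrite /= !natrM natrD natrM -(natr1 j) => E; lra.
Qed.

(** Replaces a stated range by a uniform longer one, at the cost of multiples of [d]. *)
Lemma dvd_sum_trunc (d : int) (f : nat -> int) c N :
  (forall j, (c <= j.+1)%N -> (d %| f j.+1)%Z) -> (c <= N.+1)%N ->
  (d %| \sum_(1 <= m < c) f m - \sum_(0 <= j < N) f j.+1)%Z.
Proof.
move=> fd cN; rewrite big_add1 (big_cat_nat (n := c.-1) (p := N)) //=; last by lia.
rewrite opprD addrA subrr sub0r rpredN big_nat.
by apply: rpred_sum => j /andP[cj _]; apply: fd; lia.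
Qed.

Lemma p_neg (n e : nat) : (n < e)%N -> p (n%:Z - e%:Z) = 0%N.
Proof. by move=> ne; have -> : n%:Z - e%:Z = Negz (e - n).-1 by rewrite NegzE; lia. Qed.

(** [(1 + sqrt (1 + 24 n)) / 6] is the positive root of [m (3 m - 1) / 2 = n]: the stated range
    keeps the [m] with [P_m < n]. *)
Lemma ceil_P_pos (R : realType) n j :
  (`|Num.ceil ((1 + Num.sqrt (1 + 24 * n%:R)) / 6 : R)| <= j.+1)%N = (n <= pent j)%N.
Proof.
have j0 : 0 <= j%:R :> R by [].
rewrite ceil_sqrt_le ?addr_ge0 ?sqrtr_ge0 // -?(natr1 j); last by lra.
by rewrite -(ler_nat R) pentE; apply/idP/idP => H; nra.
Qed.

Lemma sqrt_1_24_ge1 (R : realType) n : 1 <= Num.sqrt (1 + 24 * n%:R) :> R.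
Proof. by rewrite -[X in X <= _]sqrtr1 ler_sqrt ?addr_ge0 ?mulr_ge0 // lerDl mulr_ge0. Qed.

Lemma ceil_P_neg (R : realType) n j :
  (`|Num.ceil ((-1 + Num.sqrt (1 + 24 * n%:R)) / 6 : R)| <= j.+1)%N =
  (n <= pent j + j.+1)%N.
Proof.
have j0 : 0 <= j%:R :> R by [].
have s1 := sqrt_1_24_ge1 R n.
rewrite ceil_sqrt_le -?(natr1 j); [|lra|lra].
by rewrite -(ler_nat R) natrD pentE -(natr1 j); apply/idP/idP => H; nra.
Qed.

(** The floor, unlike the ceiling minus one, keeps an index with [P_(-m) = n]; hence the strict
    inequality. *)
Lemma floor_P_neg (R : realType) n j :
  (`|Num.floor ((-1 + Num.sqrt (1 + 24 * n%:R)) / 6 : R)| < j.+1)%N =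
  (n < pent j + j.+1)%N.
Proof.
have j0 : 0 <= j%:R :> R by [].
have s1 := sqrt_1_24_ge1 R n.
rewrite floor_sqrt_lt -?(natr1 j); [|lra|lra|by rewrite addr_ge0 ?mulr_ge0].
by rewrite -(ltr_nat R) natrD pentE -(natr1 j); apply/idP/idP => H; nra.
Qed.

Lemma binE (R : realType) j : 'C(j.+1, 2)%:R = (j%:R + 1) * j%:R / 2 :> R.
Proof.
have E : (2 * 'C(j.+1, 2) = j.+1 * j)%N.
  by elim: j => // j IHj; rewrite (binS j.+1 1) bin1; nia.
by have := congr1 (fun k => k%:R : R) E; rewrite /= !natrM -(natr1 j) => H; lra.
Qed.

Lemma ceil_T (R : realType) n j :
  (`|Num.ceil ((-3 + Num.sqrt (9 + 24 * n%:R)) / 6 : R)| <= j.+1)%N =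
  (n <= 3 * 'C(j.+2, 2))%N.
Proof.
have j0 : 0 <= j%:R :> R by [].
have s3 : 3 <= Num.sqrt (9 + 24 * n%:R) :> R.
  have {1}-> : 3 = Num.sqrt (3 ^+ 2) :> R by rewrite sqrtr_sqr ger0_norm.
  rewrite ler_sqrt ?addr_ge0 ?mulr_ge0 //; have : 0 <= n%:R :> R by []; lra.
rewrite ceil_sqrt_le -?(natr1 j); [|lra|lra].
by rewrite -(ler_nat R) natrM binE -(natr1 j); apply/idP/idP => H; nra.
Qed.

(** If [e = n], the factor [e] is divisible by [n]; if [e > n], the value of [p] is 0. *)
Lemma dvd_mul_np (n : nat) (c : int) (e : nat) : (n <= e)%N ->
  (n%:Z %| c * e%:Z * (p (n%:Z - e%:Z))%:Z)%Z.
Proof.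
rewrite leq_eqVlt => /predU1P[<-|ne]; last by rewrite p_neg // mulr0 dvdz0.
by rewrite mulrAC dvdz_mull.
Qed.

(** * Congruences modulo [n] *)

Lemma eqz_mod0 (n u : int) : (n %| u)%Z -> (u = 0 %[mod n])%Z.
Proof. by move=> nu; apply/eqP; rewrite eqz_mod_dvd subr0. Qed.

Lemma eqz_mod_sum (n : nat) (u a b : int) (f g h : nat -> int) N :
  u = \sum_(0 <= j < N) h j ->
  (n%:Z %| a - \sum_(0 <= j < N) f j)%Z -> (n%:Z %| b - \sum_(0 <= j < N) g j)%Z ->
  (forall j, (n%:Z %| h j - (f j + g j))%Z) ->
  (u = a + b %[mod n%:Z])%Z.
Proof.
move=> -> af bg hfg; apply/eqP; rewrite eqz_mod_dvd.
have -> : \sum_(0 <= j < N) h j - (a + b) = \sum_(0 <= j < N) (h j - (f j + g j))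
   - (a - \sum_(0 <= j < N) f j) - (b - \sum_(0 <= j < N) g j).
  by rewrite sumrB big_split /=; ring.
by apply: rpredB => //; apply: rpredB => //; apply: rpred_sum => j _; exact: hfg.
Qed.

Theorem theorem3p3 (R : realType) :
  (forall n : nat, (2 < n)%N ->
    (\sum_(1 <= m < n) (Kle (n - m))%:Z * (sigma m)%:Z =
     \sum_(1 <= m < `|Num.ceil ((1 + Num.sqrt (1 + 24 * n%:R)) / 6 : R)|%N)
        (-1) ^+ m * m%:Z * P m%:Z * (p (n%:Z - P m%:Z))%:Z
     + \sum_(1 <= m < `|Num.ceil ((-1 + Num.sqrt (1 + 24 * n%:R)) / 6 : R)|%N)
        (-1) ^+ m * m%:Z * P (- m%:Z) * (p (n%:Z - P (- m%:Z)))%:Z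
     %[mod n%:Z])%Z)
  /\
  (forall n : nat, (3 < n)%N ->
    (\sum_(1 <= m < n) (Klt (n - m))%:Z * (sigma m)%:Z
     - \sum_(1 <= m < n.+1) (Klt (n - m + 1))%:Z * (sigma m)%:Z
     + \sum_(1 <= m < `|Num.ceil ((-3 + Num.sqrt (9 + 24 * n%:R)) / 6 : R)|%N)
        (-1) ^ (m%:Z - 1) * 3 * (T m)%:Z * (p (n%:Z - 3 * (T m)%:Z))%:Z
     + \sum_(0 <= m < `|Num.floor ((-1 + Num.sqrt (1 + 24 * n%:R)) / 6 : R)|%N.+1)
        (-1) ^ (m%:Z - 1) * P (- m%:Z) * (p (n%:Z - P (- m%:Z)))%:Z
     = 0 %[mod n%:Z])%Z)
  /\
  (forall n : nat, (2 < n)%N ->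
    (\sum_(1 <= m < n) (Kgt (n - m))%:Z * (sigma m)%:Z =
     \sum_(1 <= m < `|Num.ceil ((1 + Num.sqrt (1 + 24 * n%:R)) / 6 : R)|%N)
        (-1) ^ (m%:Z - 1) * (m%:Z - 1) * P m%:Z * (p (n%:Z - P m%:Z))%:Z
     + \sum_(1 <= m < `|Num.ceil ((-1 + Num.sqrt (1 + 24 * n%:R)) / 6 : R)|%N)
        (-1) ^ (m%:Z - 1) * (m%:Z - 1) * P (- m%:Z)
          * (p (n%:Z - P (- m%:Z)))%:Z
     %[mod n%:Z])%Z).
Proof.
have predz j : j.+1%:Z - 1 = j%:Z by lia.
(* With [ceil_P_pos], this shows that [n + 1] indices cover the stated range. *)
have pentn n : (n <= pent n.+1)%N by rewrite /pent; nia.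
have pentn' n : (n <= pent n.+1 + n.+2)%N := leq_trans (pentn n) (leq_addr _ _).
split; [|split] => n n2.
- apply: (eqz_mod_sum _ _ _ _ _ _ _ n.+1 (sum_Kle_sigma n (ltnW (ltnW n2)))).
  + apply: dvd_sum_trunc => [j|]; rewrite ceil_P_pos ?pentn // => nj.
    by rewrite P_pos dvd_mul_np.
  + apply: dvd_sum_trunc => [j|]; rewrite ceil_P_neg ?pentn' // => nj.
    by rewrite P_neg dvd_mul_np.
  move=> j /=; rewrite P_pos P_neg /np exprS.
  set x := (p _)%:Z; set y := (p _)%:Z; set s := (-1) ^+ j.
  (* As [(n - e) p = n p - e p] and the stated sign is [(-1)^(j+1)], only the terms [n p] survive;
     the witness collects them. *)
  apply/dvdzP; exists (s * j.+1%:Z * (x + y)); ring.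
- rewrite sum_Klt_sigma; last by lia.
  set A := \sum_(1 <= m < _) _; set B := \sum_(0 <= m < `|_|%N.+1) _.
  have dA : (n%:Z %| A - \sum_(0 <= j < n) (-1) ^+ j * (3 * 'C(j.+2, 2))%N%:Z
                          * (p (n%:Z - (3 * 'C(j.+2, 2))%N%:Z))%:Z)%Z.
    rewrite (eq_bigr (fun j => (-1) ^ (j.+1%:Z - 1) * 3 * (T j.+1)%:Z
                          * (p (n%:Z - 3 * (T j.+1)%:Z))%:Z)); last first.
      by move=> j _; rewrite predz -exprnP T_bin PoszM mulrA.
    apply: (dvd_sum_trunc _ (fun m => (-1) ^ (m%:Z - 1) * 3 * (T m)%:Z
                          * (p (n%:Z - 3 * (T m)%:Z))%:Z)) => [j|]; rewrite ceil_T.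
      by move=> nj; rewrite T_bin -PoszM -[_ * 3 * _]mulrA -PoszM dvd_mul_np.
    by rewrite (binS n.+1 1) bin1; lia.
  have dB : (n%:Z %| B - \sum_(0 <= j < n.+1) (-1) ^+ j * (pent j + j.+1)%N%:Z
                          * (p (n%:Z - (pent j + j.+1)%N%:Z))%:Z)%Z.
    rewrite /B big_ltn //.
    (* The term [m = 0], whose sign has exponent -1, vanishes because [P_0 = 0]. *)
    rewrite [P _](_ : _ = 0) // mulr0 mul0r add0r.
    rewrite [X in _ - X](eq_bigr (fun j => (-1) ^ (j.+1%:Z - 1) * P (- j.+1%:Z)
                          * (p (n%:Z - P (- j.+1%:Z)))%:Z)); last first.
      by move=> j _; rewrite predz -exprnP P_neg.
    apply: (dvd_sum_trunc _ (fun m => (-1) ^ (m%:Z - 1) * P (- m%:Z)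
                          * (p (n%:Z - P (- m%:Z)))%:Z)) => [j|]; rewrite floor_P_neg.
      by move=> /ltnW nj; rewrite P_neg dvd_mul_np.
    by rewrite /pent; nia.
  apply: eqz_mod0.
  (* The triangular series starts at [3 T_0 = 0], giving the multiple [n p(n)]; splitting it off
     shifts the index by one and flips the sign. *)
  have -> : \sum_(0 <= j < n.+1) (-1) ^+ j *
        (np n (pent j + j.+1)%N - np n (3 * 'C(j.+1, 2))%N) =
    \sum_(0 <= j < n.+1) (-1) ^+ j * np n (pent j + j.+1)%N
    + (\sum_(0 <= j < n) (-1) ^+ j * np n (3 * 'C(j.+2, 2))%N - n%:Z * (p n)%:Z).
    rewrite (eq_bigr _ (fun j _ => mulrBr _ _ _)) sumrB; congr (_ + _).
    rewrite big_nat_recl // expr0 mul1r muln0 /np !subr0 opprD addrC -sumrN.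
    by congr (_ + _); apply: eq_bigr => j _; rewrite exprS !mulN1r mulNr opprK.
  (* Each exact sum cancels the stated one modulo [n], because [(n - e) p + e p = n p]. *)
  have dE (e : nat -> nat) N : (n%:Z %| \sum_(0 <= j < N) (-1) ^+ j * np n (e j)
      + \sum_(0 <= j < N) (-1) ^+ j * (e j)%:Z * (p (n%:Z - (e j)%:Z))%:Z)%Z.
    rewrite -big_split; apply: rpred_sum => j _ /=; rewrite /np.
    apply/dvdzP; exists ((-1) ^+ j * (p (n%:Z - (e j)%:Z))%:Z); ring.
  set a := \sum_(0 <= j < n.+1) _; set b := \sum_(0 <= j < n) _.
  set a' := \sum_(0 <= j < n.+1) _ in dB; set b' := \sum_(0 <= j < n) _ in dA.
  have -> : a + (b - n%:Z * (p n)%:Z) + A + B =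
      (a + a') + (b + b') + (A - b') + (B - a') - n%:Z * (p n)%:Z by ring.
  apply: rpredB; last exact: dvdz_mulr.
  apply: rpredD dB; apply: rpredD dA.
  apply: rpredD; first exact: (dE (fun j => pent j + j.+1)%N).
  exact: (dE (fun j => 3 * 'C(j.+2, 2))%N).
- have n0 : (0 < n)%N by lia.
  (* Subtracting the convolution for [Kle] from that for [p] gives the coefficient
     [1 - (j + 1) = - j], which is [-(m - 1)]. *)
  have E : \sum_(1 <= m < n) (Kgt (n - m))%:Z * (sigma m)%:Z =
     \sum_(0 <= j < n.+1) (-1) ^+ j * (np n (pent j) + np n (pent j + j.+1)%N) * (- j%:Z).
    under eq_bigr => m _ do rewrite Kgt_Kle mulrBl.
    rewrite sumrB sum_p_sigma // sum_Kle_sigma // -sumrB.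
    by apply: eq_bigr => j _; rewrite -[j.+1]addn1 PoszD; ring.
  apply: (eqz_mod_sum _ _ _ _ _ _ _ n.+1 E).
  + apply: dvd_sum_trunc => [j|]; rewrite ceil_P_pos ?pentn // => nj.
    by rewrite P_pos dvd_mul_np.
  + apply: dvd_sum_trunc => [j|]; rewrite ceil_P_neg ?pentn' // => nj.
    by rewrite P_neg dvd_mul_np.
  move=> j /=; rewrite P_pos P_neg predz -exprnP /np.
  set x := (p _)%:Z; set y := (p _)%:Z; set s := (-1) ^+ j.
  by apply/dvdzP; exists (- s * j%:Z * (x + y)); ring.
Qed.
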